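(* Let $n,L\ge 1$, $\sigma\in B_n$, $\mu\in\{\pm1,\dots,\pm L\}^n$, and let $f_\mu^\sigma(\bm x)$ be the partition function of the colored stochastic vertex model with U-turn boundary defined in the context. Assume that $\sigma(n)\in[n]$. Let $s_n\in B_n$ be such that $s_n(n)=\overline n$ and $s_n(j)=j$ for every $j\in\{1,\dots,n-1\}$, and let $s_n\bm x=(x_1,\dots,x_{n-1},x_n^{-1})$. Then $$q s^{-2L}\Big(\frac{1-sx_n}{s-x_n}\Big)^L f_\mu^{\sigma s_n}(\bm x)=\frac{(\sqrt q-\nu tx_n)(\sqrt q+\nu^{-1}x_n)}{t(1-x_n^2)}\left(\frac{1-qx_n^2}{x_n^2-q}\Big(\frac{s-x_n}{1-sx_n}\Big)^L f_\mu^\sigma(s_n\bm x)-\Big(\frac{1-sx_n}{s-x_n}\Big)^L f_\mu^\sigma(\bm x)\right)+\Big(\frac{1-sx_n}{s-x_n}\Big)^L f_\mu^\sigma(\bm x).$$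
   Context: **Colors.** Fix integers $n,L\ge1$. The signed colors are $[\pm n]=\{1,\dots,n,\overline n,\dots,\overline 1\}$, with positive colors $[n]=\{1,\dots,n\}$ and negative colors $[\overline n]=\{\overline1,\dots,\overline n\}$; there is also a color $0$ (also written $+$). Ordering: $1<\cdots<n<0<\overline n<\cdots<\overline1$. Put $\overline{\overline i}=i$. $B_n$ is the group of permutations $\sigma$ of $[\pm n]$ with $\sigma(\overline i)=\overline{\sigma(i)}$; the product is composition, $(\sigma\tau)(k)=\sigma(\tau(k))$. $\mathbf 1_A$ denotes an indicator. **Vectors.** $\mathbb N=\{0,1,2,\dots\}$. Vectors $\bm I=(I_1,\dots,I_n,I_{\overline n},\dots,I_{\overline1})\in\mathbb N^{2n}$ are indexed by $[\pm n]$, with standard basis $\bm e_k$ ($k\in[\pm n]$), and $\bm e_0=0$. Put $\bm I_{[j,j']}=\sum_{k\in[\pm n],\,j\le k\le j'}I_k$, and similarly $\bm I_{<j},\bm I_{>j},\bm I_{\le j},\bm I_{\ge j}$ (sums over $k\in[\pm n]$); $\bm I_\ell=I_\ell$. **Parameters.** $q,\nu,t\in\mathbb C$, $s\in\mathbb C^*$, $\bm x=(x_1,\dots,x_n)$ complex spectral parameters, with a fixed square root $\sqrt q=q^{1/2}$ of $q$. Parameters are assumed to be such that all denominators that occur are nonzero (in particular $q,\nu,t,x_i\neq0$); the identities are identities of rational functions. **$\Gamma$ weights.** $\mathcal L_x(\bm I,j,\bm K,\ell)$ is for a vertex with bottom edge $\bm I$, left edge $j$, top edge $\bm K$, right edge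 $\ell$ ($j,\ell\in\{0\}\cup[\pm n]$, $\bm I,\bm K\in\mathbb N^{2n}$). It is $0$ unless $\bm I+\bm e_j=\bm K+\bm e_\ell$, in which case it equals: - $\ell=0$: $\frac{q^{-\bm I_{[1,n]}}-sxq^{\bm I_{[\overline n,\overline1]}}}{1-sx}$ if $j=\ell$; $\frac{xq^{-\bm I_{[1,n]}}-s^2xq^{\bm I_{[\overline n,\overline1]}}}{s(1-sx)}$ if $j<\ell$; $\frac{q^{-\bm I_{[1,n]}}-s^2q^{\bm I_{[\overline n,\overline1]}}}{1-sx}$ if $j>\ell$. - $\ell\in[n]$: $\frac{(sq^{\bm I_\ell}-x)q^{-\bm I_{\le\ell}}}{s(1-sx)}$ if $j=\ell$; $\frac{-x(1-q^{\bm I_\ell})q^{-\bm I_{\le\ell}}}{s(1-sx)}$ if $j<\ell$; $\frac{-(1-q^{\bm I_\ell})q^{-\bm I_{\le\ell}}}{1-sx}$ if $j>\ell$. - $\ell\in[\overline n]$: $\frac{s(sq^{\bm I_\ell}-x)q^{\bm I_{>\ell}}}{1-sx}$ if $j=\ell$; $\frac{-sx(1-q^{\bm I_\ell})q^{\bm I_{>\ell}}}{1-sx}$ if $j<\ell$; $\frac{-s^2(1-q^{\bm I_\ell})q^{\bm I_{>\ell}}}{1-sx}$ if $j>\ell$. **$\Delta$ weights.** $\mathcal M_x(\bm I,j,\bm K,\ell)$ is for a vertex with bottom edge $\bm I$, right edge $j$, top edge $\bm K$, left edge $\ell$. It is $0$ unless $\bm I+\bm e_j=\bm K+\bm e_\ell$,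 in which case it equals: - $\ell=0$: $\frac{q^{-\bm I_{[\overline n,\overline1]}}-sxq^{\bm I_{[1,n]}}}{1-sx}$ if $j=\ell$; $\frac{q^{-\bm I_{[\overline n,\overline1]}}-s^2q^{\bm I_{[1,n]}}}{1-sx}$ if $j<\ell$; $\frac{x(s^{-1}q^{-\bm I_{[\overline n,\overline1]}}-sq^{\bm I_{[1,n]}})}{1-sx}$ if $j>\ell$. - $\ell\in[n]$: $\frac{s(sq^{\bm I_\ell}-x)q^{\bm I_{<\ell}}}{1-sx}$ if $j=\ell$; $\frac{-s^2(1-q^{\bm I_\ell})q^{\bm I_{<\ell}}}{1-sx}$ if $j<\ell$; $\frac{-sx(1-q^{\bm I_\ell})q^{\bm I_{<\ell}}}{1-sx}$ if $j>\ell$. - $\ell\in[\overline n]$: $\frac{(1-s^{-1}xq^{-\bm I_\ell})q^{-\bm I_{>\ell}}}{1-sx}$ if $j=\ell$; $\frac{-(1-q^{\bm I_\ell})q^{-\bm I_{\ge\ell}}}{1-sx}$ if $j<\ell$; $\frac{-s^{-1}x(1-q^{\bm I_\ell})q^{-\bm I_{\ge\ell}}}{1-sx}$ if $j>\ell$. **Cap weights.** Let $\phi(x)=\frac{1-x^2}{(1-\nu tx)(1+\nu^{-1}x)}$. Let $\mathcal C_x(a,b)$ be the weight of a cap with bottom edge $a$ and top edge $b$: $\mathcal C_x(0,0)=1$, and for $i\in[n]$, $\mathcal C_x(i,\overline i)=t\phi(q^{-1/2}x^{-1})$, $\mathcal C_x(i,i)=1-t\phi(q^{-1/2}x^{-1})$,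 $\mathcal C_x(\overline i,i)=\phi(q^{-1/2}x^{-1})$, $\mathcal C_x(\overline i,\overline i)=1-\phi(q^{-1/2}x^{-1})$; all other values are $0$. **Model and partition function.** The lattice has $2n$ rows, labeled $1,\dots,2n$ from top to bottom, and $L$ columns, labeled $1,\dots,L$ from right to left. Even rows consist of $\Gamma$ vertices, odd rows of $\Delta$ vertices; rows $2i-1$ and $2i$ have spectral parameter $x_i$ and are joined on the right by a cap with parameter $x_i$. Given $\sigma\in B_n$ and $\mu\in\{\pm1,\dots,\pm L\}^n$, a state is an assignment of horizontal labels $h_{r,c}\in\{0\}\cup[\pm n]$ ($1\le r\le2n$, $0\le c\le L$) and vertical labels $V_{r,c}\in\mathbb N^{2n}$ ($0\le r\le2n$, $1\le c\le L$), where the vertex in row $r$ and column $c$ has left edge $h_{r,c}$, right edge $h_{r,c-1}$, bottom edge $V_{r,c}$, top edge $V_{r-1,c}$, with boundary conditions: $h_{2i-1,L}=0$ and $h_{2i,L}=\sigma(i)$ for $i\in[n]$; $V_{2n,c}=\bm e_0$ for all $c$; $V_{0,c}=\sum_{i=1}^n(\mathbf 1_{\mu_i=c}\bm e_i+\mathbf 1_{\mu_i=-c}\bm e_{\overline i})$. The partition function $f_\mu^\sigma(\bm x)$ is the sum over all states of $$\prod_{i=1}^n\Big(\mathcal C_{x_i}(h_{2i,0},h_{2i-1,0})\prod_{c=1}^L\mathcal L_{x_i}(V_{2i,c},h_{2i,c},V_{2i-1,c},h_{2i,c-1})\,\mathcal M_{x_i}(V_{2i-1,c},h_{2i-1,c-1},V_{2i-2,c},h_{2i-1,c})\Big).$$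 Only finitely many states contribute. *)

(* Defs.v *)
From HB Require Import structures.
From mathcomp Require Import all_boot all_order all_algebra all_fingroup.
From mathcomp Require Import complex.
From mathcomp Require Import mathcomp_extra boolp classical_sets functions.
From mathcomp Require Import cardinality fsbigop reals.
From mathcomp Require Import zify.

Set Implicit Arguments.
Unset Strict Implicit.
Unset Printing Implicit Defensive.

Import Order.TTheory GRing.Theory Num.Theory.
Local Open Scope ring_scope.

(* [inl i] is the positive color i+1 and [inr i] its negative; in [color],
   [None] is the color 0. *)
Definition scolor (n : nat) : Type := ('I_n + 'I_n)%type.
HB.instance Definition _ (n : nat) := Finite.on (scolor n).

Definition color (n : nat) : Type := option (scolor n).
HB.instance Definition _ (n : nat) := Finite.on (color n).

Definition bar (n : nat) (k : scolor n) : scolor n :=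
  match k with inl i => inr i | inr i => inl i end.

Definition is_pos (n : nat) (k : scolor n) : bool :=
  if k is inl _ then true else false.

Definition is_neg (n : nat) (k : scolor n) : bool := ~~ is_pos k.

(* Position in the chain 1 < ... < n < 0 < -n < ... < -1, counted from 0. *)
Definition crank (n : nat) (a : color n) : nat :=
  match a with
  | Some (inl i) => i
  | None => n
  | Some (inr i) => n.*2 - i
  end.

Definition clt (n : nat) (a b : color n) : bool := (crank a < crank b)%N.
Definition cle (n : nat) (a b : color n) : bool := (crank a <= crank b)%N.

Definition hyperoctahedral (n : nat) : {set {perm scolor n}} :=
  [set sigma : {perm scolor n} | [forall k, sigma (bar k) == bar (sigma k)]].

(* Composition [k |-> sigma (tau k)]; the product of {perm _} is in the
   opposite order. *)
Definition perm_comp (n : nat) (sigma tau : {perm scolor n}) : {perm scolor n} :=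
  (tau * sigma)%g.

Definition cvec (n : nat) : Type := {ffun scolor n -> nat}.
HB.instance Definition _ (n : nat) := Choice.on (cvec n).
HB.instance Definition _ (n : nat) := GRing.Nmodule.on (cvec n).

(* In particular [evec None = 0]. *)
Definition evec (n : nat) (j : color n) : cvec n :=
  [ffun k => (Some k == j) : nat].

Definition sum_on (n : nat) (P : pred (scolor n)) (I : cvec n) : nat :=
  (\sum_(k | P k) I k)%N.

Definition sum_pos (n : nat) (I : cvec n) : nat := sum_on (@is_pos n) I.
Definition sum_neg (n : nat) (I : cvec n) : nat := sum_on (@is_neg n) I.
Definition sum_lt (n : nat) (I : cvec n) (l : scolor n) : nat :=
  sum_on (fun k => clt (Some k) (Some l)) I.
Definition sum_le (n : nat) (I : cvec n) (l : scolor n) : nat :=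
  sum_on (fun k => cle (Some k) (Some l)) I.
Definition sum_gt (n : nat) (I : cvec n) (l : scolor n) : nat :=
  sum_on (fun k => clt (Some l) (Some k)) I.
Definition sum_ge (n : nat) (I : cvec n) (l : scolor n) : nat :=
  sum_on (fun k => cle (Some l) (Some k)) I.

Section Weights.
Variables (F : fieldType) (n : nat).

(* Bottom edge I, left edge j, top edge K, right edge l. *)
Definition gamma_weight (q s x : F) (I : cvec n) (j : color n) (K : cvec n)
    (l : color n) : F :=
  if I + evec j != K + evec l then 0 else
  match l with
  | None =>
      if j == l then
        (q ^- sum_pos I - s * x * q ^+ sum_neg I) / (1 - s * x)
      else if clt j l then
        (x * q ^- sum_pos I - s ^+ 2 * x * q ^+ sum_neg I) / (s * (1 - s * x))
      else
        (q ^- sum_pos I - s ^+ 2 * q ^+ sum_neg I) / (1 - s * x)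
  | Some k =>
      if is_pos k then
        if j == l then
          (s * q ^+ I k - x) * q ^- sum_le I k / (s * (1 - s * x))
        else if clt j l then
          - x * (1 - q ^+ I k) * q ^- sum_le I k / (s * (1 - s * x))
        else
          - (1 - q ^+ I k) * q ^- sum_le I k / (1 - s * x)
      else
        if j == l then
          s * (s * q ^+ I k - x) * q ^+ sum_gt I k / (1 - s * x)
        else if clt j l then
          - s * x * (1 - q ^+ I k) * q ^+ sum_gt I k / (1 - s * x)
        else
          - s ^+ 2 * (1 - q ^+ I k) * q ^+ sum_gt I k / (1 - s * x)
  end.

(* Bottom edge I, right edge j, top edge K, left edge l. *)
Definition delta_weight (q s x : F) (I : cvec n) (j : color n) (K : cvec n)
    (l : color n) : F :=
  if I + evec j != K + evec l then 0 else
  match l with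
  | None =>
      if j == l then
        (q ^- sum_neg I - s * x * q ^+ sum_pos I) / (1 - s * x)
      else if clt j l then
        (q ^- sum_neg I - s ^+ 2 * q ^+ sum_pos I) / (1 - s * x)
      else
        x * (s^-1 * q ^- sum_neg I - s * q ^+ sum_pos I) / (1 - s * x)
  | Some k =>
      if is_pos k then
        if j == l then
          s * (s * q ^+ I k - x) * q ^+ sum_lt I k / (1 - s * x)
        else if clt j l then
          - s ^+ 2 * (1 - q ^+ I k) * q ^+ sum_lt I k / (1 - s * x)
        else
          - s * x * (1 - q ^+ I k) * q ^+ sum_lt I k / (1 - s * x)
      else
        if j == l then
          (1 - s^-1 * x * q ^- I k) * q ^- sum_gt I k / (1 - s * x)
        else if clt j l then
          - (1 - q ^+ I k) * q ^- sum_ge I k / (1 - s * x)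
        else
          - s^-1 * x * (1 - q ^+ I k) * q ^- sum_ge I k / (1 - s * x)
  end.

Definition phi_den (nu t y : F) : F := (1 - nu * t * y) * (1 + nu^-1 * y).

Definition phi (nu t y : F) : F := (1 - y ^+ 2) / phi_den nu t y.

(* Bottom edge a, top edge b. *)
Definition cap_weight (sqrtq nu t x : F) (a b : color n) : F :=
  let p := phi nu t (sqrtq^-1 * x^-1) in
  match a with
  | None => if b == None then 1 else 0
  | Some k =>
      let c := if is_pos k then t * p else p in
      if b == Some (bar k) then c else if b == Some k then 1 - c else 0
  end.

End Weights.

(* Rows 2i-1 and 2i (i = 1, ..., n), as elements of 'I_(2n). *)
Lemma odd_row_subproof (n : nat) (i : 'I_n) : (i.*2 < n.*2)%N.
Proof. by rewrite ltn_double. Qed.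

Lemma even_row_subproof (n : nat) (i : 'I_n) : (i.*2.+1 < n.*2)%N.
Proof. by rewrite ltn_Sdouble. Qed.

Definition odd_row (n : nat) (i : 'I_n) : 'I_(n.*2) :=
  Ordinal (odd_row_subproof i).
Definition even_row (n : nat) (i : 'I_n) : 'I_(n.*2) :=
  Ordinal (even_row_subproof i).

(* Rows and columns are labelled from 1, so that i : 'I_m stands for the label
   i+1; [lab_at i] and [lab_before i] are the labels i+1 and i in {0, ..., m}. *)
Definition lab_at (m : nat) (i : 'I_m) : 'I_m.+1 := lift ord0 i.
Definition lab_before (m : nat) (i : 'I_m) : 'I_m.+1 := widen_ord (leqnSn m) i.

(* The labels h_(r,c) and V_(r,c): r ranges over the 2n rows and c over
   {0, ..., L} in h, r over {0, ..., 2n} and c over the L columns in V. *)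
Definition state (n L : nat) : Type :=
  ({ffun 'I_(n.*2) * 'I_L.+1 -> color n} *
   {ffun 'I_(n.*2).+1 * 'I_L -> cvec n})%type.
HB.instance Definition _ (n L : nat) := Choice.on (state n L).

Definition hlab (n L : nat) (S : state n L) (r : 'I_(n.*2)) (c : 'I_L.+1) :
  color n := S.1 (r, c).
Definition vlab (n L : nat) (S : state n L) (r : 'I_(n.*2).+1) (c : 'I_L) :
  cvec n := S.2 (r, c).

Definition top_label (n L : nat) (mu : 'I_n -> int) (c : 'I_L) : cvec n :=
  \sum_(i < n) ((if mu i == c.+1%:Z then evec (Some (inl i)) else 0)
              + (if mu i == - c.+1%:Z then evec (Some (inr i)) else 0)).

Definition boundary (n L : nat) (sigma : {perm scolor n}) (mu : 'I_n -> int)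
    (S : state n L) : Prop :=
  [/\ forall i : 'I_n, hlab S (odd_row i) ord_max = None,
      forall i : 'I_n, hlab S (even_row i) ord_max = Some (sigma (inl i)),
      forall c : 'I_L, vlab S ord_max c = evec None
    & forall c : 'I_L, vlab S ord0 c = top_label mu c].

Section PartitionFunction.
Variables (F : fieldType) (n L : nat) (q sqrtq nu t s : F).

Definition state_weight (x : 'I_n -> F) (S : state n L) : F :=
  \prod_(i < n)
    (cap_weight sqrtq nu t (x i)
       (hlab S (even_row i) ord0) (hlab S (odd_row i) ord0) *
     \prod_(c < L)
       (gamma_weight q s (x i)
          (vlab S (lab_at (even_row i)) c) (hlab S (even_row i) (lab_at c))
          (vlab S (lab_before (even_row i)) c) (hlab S (even_row i) (lab_before c)) *
        delta_weight q s (x i)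
          (vlab S (lab_at (odd_row i)) c) (hlab S (odd_row i) (lab_before c))
          (vlab S (lab_before (odd_row i)) c) (hlab S (odd_row i) (lab_at c)))).

(* The sum over all states, of which finitely many have a nonzero weight
   ([finite_contributing_states]). *)
Definition partition_function (sigma : {perm scolor n}) (mu : 'I_n -> int)
    (x : 'I_n -> F) : F :=
  \sum_(S \in [set S : state n L | boundary sigma mu S]%classic)
    state_weight x S.

(* The denominators of the weights at the spectral parameters x are nonzero. *)
Definition regular_at (x : 'I_n -> F) : Prop :=
  forall i : 'I_n,
    [/\ x i != 0, 1 - s * x i != 0
      & phi_den nu t (sqrtq^-1 * (x i)^-1) != 0].

End PartitionFunction.

Lemma gamma_weight_neq0 (F : fieldType) (n : nat) (q s x : F) (I K : cvec n)
    (j l : color n) :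
  gamma_weight q s x I j K l != 0 -> I + evec j = K + evec l.
Proof. by rewrite /gamma_weight; case: (I + evec j =P K + evec l) => // _; rewrite eqxx. Qed.

Lemma delta_weight_neq0 (F : fieldType) (n : nat) (q s x : F) (I K : cvec n)
    (j l : color n) :
  delta_weight q s x I j K l != 0 -> I + evec j = K + evec l.
Proof. by rewrite /delta_weight; case: (I + evec j =P K + evec l) => // _; rewrite eqxx. Qed.

Lemma state_weight_conserved (F : fieldType) (n L : nat)
    (q sqrtq nu t s : F) (x : 'I_n -> F) (S : state n L) :
  state_weight q sqrtq nu t s x S != 0 ->
  forall (r : 'I_(n.*2)) (c : 'I_L), exists j l : color n,
    vlab S (lab_at r) c + evec j = vlab S (lab_before r) c + evec l.
Proof.
move=> /prodf_neq0 W r c.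
have ltr : (r./2 < n)%N by rewrite ltn_half_double.
have := W (Ordinal ltr) isT.
rewrite mulf_eq0 negb_or => /andP[_ /prodf_neq0/(_ c isT)].
rewrite mulf_eq0 negb_or => /andP[].
move=> /gamma_weight_neq0 Eg /delta_weight_neq0 Ed.
case odr: (odd r).
- have -> : r = even_row (Ordinal ltr).
    by apply: val_inj; rewrite /= -[LHS]odd_double_half odr.
  by eexists; eexists; exact: Eg.
- have -> : r = odd_row (Ordinal ltr).
    by apply: val_inj; rewrite /= -[LHS]odd_double_half odr.
  by eexists; eexists; exact: Ed.
Qed.

Lemma finite_contributing_states (F : fieldType) (n L : nat)
    (q sqrtq nu t s : F) (sigma : {perm scolor n}) (mu : 'I_n -> int)
    (x : 'I_n -> F) :
  finite_set ([set S : state n L | boundary sigma mu S] `&`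
              [set S | state_weight q sqrtq nu t s x S != 0])%classic.
Proof.
pose M := (\sum_(c < L) \sum_(k : scolor n) top_label mu c k)%N.
pose B := (M + n.*2)%N.
pose T := ({ffun 'I_(n.*2) * 'I_L.+1 -> color n} *
  {ffun 'I_(n.*2).+1 * 'I_L -> {ffun scolor n -> 'I_B.+1}})%type.
pose g (y : T) : state n L :=
  (y.1, [ffun rc => [ffun k => (y.2 rc k : nat)] : cvec n]).
have finT : finite_set [set: T]%classic by exact: finite_finset.
apply: (@sub_finite_set _ _ (g @` [set: T])%classic); last exact: finite_image.
move=> S [[_ _ _ top]] /state_weight_conserved W.
have bound (m : nat) (r : 'I_(n.*2).+1) c k : r = m :> nat ->
    (vlab S r c k <= M + m)%N.
  elim: m r => [|m IH] r rm.
    have -> : r = ord0 by exact: val_inj.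
    rewrite top addn0 /M (bigD1 c) //= (bigD1 k) //= -addnA.
    exact: leq_addr.
  have ltm : (m < n.*2)%N by rewrite -ltnS -rm.
  have -> : r = lab_at (Ordinal ltm) by apply: val_inj; rewrite /= rm.
  have [j [l]] := W (Ordinal ltm) c.
  move=> /(congr1 (fun f : cvec n => f k)); rewrite !ffunE => E.
  have := IH (lab_before (Ordinal ltm)) erefl.
  have : (evec l k <= 1)%N by rewrite ffunE; case: (_ == _).
  move: E; rewrite !ffunE -!plusE.
  move: (vlab S _ c k) (vlab S _ c k) => a b.
  case: (_ == j); case: (_ == l) => /= E _ Hb; lia.
exists (S.1, [ffun rc => [ffun k => inord (S.2 rc k)]]) => //.
rewrite [RHS]surjective_pairing /g /=; congr pair.
apply/ffunP => rc; rewrite !ffunE; apply/ffunP => k; rewrite !ffunE inordK //.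
case: rc => r c; rewrite ltnS (leq_trans (bound r r c k erefl)) //.
by rewrite leq_add2l -ltnS.
Qed.

(* The action of s_n on the spectral parameters. *)
Definition invert_last (F : fieldType) (n : nat) (x : 'I_n.+1 -> F) :
  'I_n.+1 -> F := fun i => if i == ord_max then (x i)^-1 else x i.

(* Main.v *)
(* No color other than c = sigma(n) and its bar meets the last two rows, so these
   rows contain a single path. It enters row 2n from the left with color c and
   either turns up in a column or goes through the cap, where it may become
   bar c; in both cases it then runs to the left in row 2n-1 and leaves that row
   upwards in some column d with some color k. Hence
     f^sigma(x) = sum_(d, k) Z_c(x_n; d, k) U(d, k),
   where Z_c is the weight of the two rows and U, the weight of the rest of the
   lattice, depends neither on x_n nor on sigma(n). The theorem is thus a
   relation between Z_(bar c)(x), Z_c(x) and Z_c(1/x) for each (d, k). With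
   y = (s - x)/(1 - s x), which becomes 1/y under x -> 1/x, the sum over the
   turning column of row 2n is a geometric sum in y^2. After the normalization
   by y^L, each Z is a combination of y^d, y^-d and
   H = y (1 + y^2 + ... + y^(2d-2)) / y^d = (y^d - y^-d)/(y - y^-1);
   as H is invariant under y -> 1/y, the relation reduces to two identities of
   rational functions, linear in H and y^-d. *)
Require Import Defs.
From mathcomp Require Import all_boot all_order all_algebra all_fingroup.
From mathcomp Require Import complex.
From mathcomp Require Import finmap boolp classical_sets functions.
From mathcomp Require Import cardinality fsbigop reals.
From mathcomp Require Import zify ring.

Set Implicit Arguments.
Unset Strict Implicit.
Unset Printing Implicit Defensive.

Import GRing.Theory.
Local Open Scope ring_scope.

(** * Summation over states and multiplicity vectors *)

(** Both sides reduce to finite sums over the support [r], each point of which lies in exactly one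
    [B p], so exchanging the sums suffices. The pieces need only cover the support: states of weight
    zero may stay outside all of them. *)
Lemma fsbig_partition (V : nmodType) (T : choiceType) (P : finType)
    (A : set T) (B : P -> set T) (F : T -> V) :
  finite_set (A `&` [set x | F x != 0])%classic ->
  (forall p, (B p `<=` A)%classic) ->
  (forall x, A x -> F x != 0 -> exists p, B p x) ->
  (forall p p' x, B p x -> B p' x -> p = p') ->
  \sum_(x \in A) F x = \sum_p \sum_(x \in B p) F x.
Proof.
move=> fin sBA cov disj.
pose r := fset_set (A `&` [set x | F x != 0])%classic.
have rP x : reflect (A x /\ F x != 0) (x \in r).
  by rewrite in_fset_set //; apply: (iffP idP) => [/set_mem|/mem_set].
have Br p : \sum_(x \in B p) F x = \sum_(x <- r) if x \in B p then F x else 0.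
  rewrite -big_mkcond [RHS]bigfs ?fset_uniq //.
    by apply: eq_fsbigl; rewrite set_mem_set.
  move=> x /set_mem Bx /rP nr; apply/eqP/negPn/negP => Fx.
  by apply: nr; split=> //; apply: sBA Bx.
rewrite (eq_bigr _ (fun p _ => Br p)) exchange_big /=.
rewrite (fsbigE r) ?fset_uniq //; last 2 first.
- by move=> x /= /rP[].
- by move=> x Ax /rP nr; apply/eqP/negPn/negP => Fx; apply: nr.
rewrite big_seq_cond [RHS]big_seq_cond big_mkcond [RHS]big_mkcond /=.
apply: eq_bigr => x _; rewrite andbT; case: (rP x) => //= -[Ax Fx].
rewrite mem_set //; have [p Bp] := cov x Ax Fx.
rewrite (bigD1 p) //= mem_set // big1 ?addr0 // => p' np.
by rewrite memNset // => /disj/(_ Bp)/eqP; rewrite (negPf np).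
Qed.

Section Vectors.
Variable n : nat.
Implicit Types (I K : cvec n) (k : scolor n) (j l : color n).

Lemma cvecP I K : (forall k : scolor n, I k = K k) -> I = K.
Proof. by move=> E; apply/ffunP. Qed.

Lemma evecE j k : evec j k = (Some k == j).
Proof. by rewrite ffunE. Qed.

Lemma evec_None : evec None = 0 :> cvec n.
Proof. by apply/ffunP => k; rewrite !ffunE. Qed.

Lemma cvec0E k : (0 : cvec n) k = 0%N.
Proof. by rewrite ffunE. Qed.

Lemma cvecDE I K k : (I + K) k = (I k + K k)%N.
Proof. by rewrite ffunE. Qed.

Lemma evec_inj : injective (@evec n).
Proof.
move=> j l /ffunP E; case: j l E => [j|] [l|] // E.
- by have := E j; rewrite !evecE eqxx; case: eqP.
- by have := E j; rewrite !evecE eqxx.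
- by have := E l; rewrite !evecE eqxx.
Qed.

Lemma addr_evec_eq0 K l : K + evec l = 0 -> K = 0 /\ l = None.
Proof.
move=> E; have {}E k := congr1 (fun f : cvec n => f k) E.
split.
  by apply: cvecP => k; have := E k; rewrite cvecDE !cvec0E; lia.
by case: l E => // k /(_ k); rewrite cvecDE cvec0E evecE eqxx addn1.
Qed.

(** Conservation at a vertex entered by a single path: it leaves horizontally in the first case and
    upwards in the second. *)
Lemma addr_evec_eq_evec K k l :
  K + evec l = evec (Some k) ->
  l = Some k /\ K = 0 \/ l = None /\ K = evec (Some k).
Proof.
case: l => [l|]; last by rewrite evec_None addr0; right.
move=> E; have {}E k' := congr1 (fun f : cvec n => f k') E.
have lk : l = k.
  have := E l; rewrite cvecDE !evecE eqxx addn1.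
  by case: eqP => // -[].
rewrite lk in E *; left; split=> //; apply: cvecP => k'.
by have := E k'; rewrite cvecDE cvec0E; lia.
Qed.

Lemma sum_on0 (P : pred (scolor n)) : sum_on P 0 = 0%N.
Proof. by rewrite /sum_on big1 // => k _; rewrite ffunE. Qed.

Lemma sum_on_evec (P : pred (scolor n)) k : sum_on P (evec (Some k)) = P k.
Proof.
rewrite /sum_on big_mkcond (bigD1 k) //= big1 => [|k' nk].
  by rewrite evecE eqxx addn0; case: (P k).
by rewrite evecE (inj_eq Some_inj) (negPf nk) if_same.
Qed.

End Vectors.

(** * The path in the last two rows *)

Section Paths.
Variable n : nat.
Implicit Types (h : nat -> color n) (V K : nat -> cvec n) (c k : scolor n).

Lemma no_path L h V :
  h L = None -> (forall j, (j < L)%N -> evec (h j.+1) = V j + evec (h j)) ->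
  forall j, (j <= L)%N -> h j = None.
Proof.
elim: L => [|L IH] hL cons j; first by case: j.
rewrite leq_eqVlt => /predU1P[-> //|ltj].
apply: IH => // [|i lti]; last by apply: cons; rewrite ltnS ltnW.
have := cons L (ltnSn L); rewrite hL evec_None => /esym/addr_evec_eq0[_ ->] //.
Qed.

(** Columns are numbered from right to left, so the path enters at [j = L] and is followed by
    decreasing [j]. The vertical index [j] is column [j.+1]; thus [a = 0] means that the path never
    turns up and reaches the cap. *)
Lemma gamma_path L h V c :
  h L = Some c ->
  (forall j, (j < L)%N -> evec (h j.+1) = V j + evec (h j)) ->
  exists2 a, (a <= L)%N &
    (forall j, (j <= L)%N -> h j = if (a <= j)%N then Some c else None) /\
    (forall j, (j < L)%N -> V j = if j.+1 == a then evec (Some c) else 0).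
Proof.
elim: L => [|L IH] hL cons; first by exists 0%N => //; split=> // -[].
have consL j : (j < L)%N -> evec (h j.+1) = V j + evec (h j).
  by move=> ltj; apply: cons; rewrite ltnS ltnW.
have := cons L (ltnSn L); rewrite hL => /esym/addr_evec_eq_evec[[hL' VL]|[hL' VL]].
- have [a lea [ha Va]] := IH hL' consL.
  exists a; first exact: leqW.
  split=> j; first by rewrite leq_eqVlt => /predU1P[->|/ha //]; rewrite leqW.
  rewrite ltnS leq_eqVlt => /predU1P[->|/Va //].
  by rewrite VL gtn_eqF.
- exists L.+1 => //.
  have hN := no_path hL' consL.
  split=> j; first by rewrite leq_eqVlt => /predU1P[->|ltj]; rewrite ?leqnn // hN // leqNgt ltj.
  rewrite ltnS leq_eqVlt => /predU1P[->|ltj]; first by rewrite eqxx.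
  rewrite eqn_leq andbC leqNgt ltnS ltj /=.
  have := consL j ltj; rewrite !hN // ?(ltnW ltj) // evec_None => /esym.
  by rewrite addr0.
Qed.

(** Here the path runs to the left, by increasing [j], having come through the cap if [a = 0] and
    from below in column [a] otherwise. It leaves in column [d.+1]; the extreme case [a = d.+1] is a
    path going straight up through one column. *)
Lemma delta_path L h K a k :
  (a <= L)%N -> h 0%N = (if a == 0%N then Some k else None) -> h L = None ->
  (forall j, (j < L)%N ->
     (if j.+1 == a then evec (Some k) else 0) + evec (h j) =
     K j + evec (h j.+1)) ->
  exists2 d, (d < L)%N && (a <= d.+1)%N &
    (forall j, (j <= L)%N -> h j = if (a <= j <= d)%N then Some k else None) /\
    (forall j, (j < L)%N -> K j = if j == d then evec (Some k) else 0).
Proof.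
move=> leaL h0 hL cons.
(* Up to edge [m], either the path has not left the row ([alive]; it may not have entered yet), or
   it has left upwards at index [d] ([stop]). *)
pose alive m := forall j, (j <= m)%N -> h j = if (a <= j)%N then Some k else None.
pose stop m d := [/\ (d < m)%N, (a <= d.+1)%N &
  forall j, (j <= m)%N -> h j = if (a <= j <= d)%N then Some k else None].
have ind m : (m <= L)%N -> alive m \/ exists d, stop m d.
  elim: m => [|m IH] ltm.
    by left=> -[|//] _; rewrite h0 leqn0.
  have {IH} [al|[d [ltd lead hd]]] := IH (ltnW ltm).
    have := cons m ltm; rewrite al //.
    have extend : h m.+1 = (if (a <= m.+1)%N then Some k else None) -> alive m.+1.
      by move=> hm j; rewrite leq_eqVlt => /predU1P[-> //|/al].
    have stops : (a <= m.+1)%N -> h m.+1 = None -> stop m.+1 m.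
      move=> leam hm; split=> // j; rewrite leq_eqVlt => /predU1P[->|ltj].
        by rewrite hm ltnn andbF.
      by rewrite al // (ltj : (j <= m)%N) andbT.
    (* The column lies to the right of the entry column and is empty, or to its left, or is the
       entry column itself; in the last two cases the path goes on to the left or leaves upwards. *)
    case: (ltngtP m.+1 a) => [ltma|ltam|eqma].
    - rewrite leqNgt (ltnW ltma) /= evec_None addr0 => /esym/addr_evec_eq0[_ hm].
      by left; apply: extend; rewrite hm leqNgt ltma.
    - rewrite -ltnS ltam add0r => /esym/addr_evec_eq_evec[[hm _]|[hm _]].
        by left; apply: extend; rewrite hm ltnW.
      by right; exists m; apply: stops => //; exact: ltnW.
    - rewrite -eqma ltnn evec_None addr0 => /esym/addr_evec_eq_evec[[hm _]|[hm _]].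
        by left; apply: extend; rewrite hm eqma leqnn.
      by right; exists m; apply: stops => //; rewrite eqma leqnn.
  right; exists d; split=> //; first exact: ltnW.
  move=> j; rewrite leq_eqVlt => /predU1P[->|/hd //].
  have -> : (m.+1 <= d)%N = false by lia.
  rewrite andbF.
  have := cons m ltm; rewrite (hd m) // leqNgt [(m <= d)%N]leqNgt ltd andbF.
  by rewrite gtn_eqF ?(leq_ltn_trans lead) // evec_None addr0 => /esym/addr_evec_eq0[].
have [al|[d [ltd lead hd]]] := ind L (leqnn L).
  by have := al L (leqnn L); rewrite hL leaL.
exists d; first by rewrite ltd.
(* The horizontal labels being known, conservation determines [K], color by color. *)
split=> // j ltj; have := cons j ltj; rewrite !hd ?(ltnW ltj) // => E.
apply: cvecP => k'.
have := congr1 (fun f : cvec n => f k') E; rewrite /= !cvecDE.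
have evec_if (b : bool) : (if b then evec (Some k) else 0) k' = (b && (k' == k)) :> nat.
  by case: b; rewrite ?cvec0E // evecE (inj_eq Some_inj).
have evec_ifN (b : bool) : evec (if b then Some k else None) k' = (b && (k' == k)) :> nat.
  by case: b; rewrite evecE // (inj_eq Some_inj).
rewrite !evec_if !evec_ifN; case: (k' == k); rewrite ?andbT ?andbF //; last lia.
move: ltd lead ltj; clear; lia.
Qed.

End Paths.

(** * Factoring out the last two rows *)

Lemma lab_at_odd_row N (i : 'I_N) : lab_at (odd_row i) = lab_before (even_row i).
Proof. exact: val_inj. Qed.

Lemma lab_at_even_row_max n :
  lab_at (even_row (ord_max : 'I_n.+1)) = ord_max.
Proof. exact: val_inj. Qed.

Section Grafting.
Variables n L : nat.
Implicit Types (S T : state n.+1 L) (sigma : {perm scolor n.+1}).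

Let last : 'I_n.+1 := ord_max.

(** The last two rows of [T] below the other rows of [S]. The vertical labels at the interface, of
    index [n.*2], are taken from [S], so agreement with [T] there has to be required separately. *)
Definition graft S T : state n.+1 L :=
  ([ffun rj : 'I_(n.+1.*2) * 'I_L.+1 =>
      if (rj.1 < n.*2)%N then S.1 rj else T.1 rj],
   [ffun rc : 'I_(n.+1.*2).+1 * 'I_L =>
      if (rc.1 <= n.*2)%N then S.2 rc else T.2 rc]).

Lemma hlab_graft S T r j :
  hlab (graft S T) r j = if (r < n.*2)%N then hlab S r j else hlab T r j.
Proof. by rewrite /hlab ffunE. Qed.

Lemma vlab_graft S T r c :
  vlab (graft S T) r c = if (r <= n.*2)%N then vlab S r c else vlab T r c.
Proof. by rewrite /vlab ffunE. Qed.

Lemma graft_graft S T T' : graft (graft S T) T' = graft S T'.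
Proof.
by congr pair; apply/ffunP => -[r c]; rewrite !ffunE /=; case: ifP => // ->.
Qed.

Lemma graft_eq S T :
  (forall j, hlab S (even_row last) j = hlab T (even_row last) j) ->
  (forall j, hlab S (odd_row last) j = hlab T (odd_row last) j) ->
  (forall c, vlab S ord_max c = vlab T ord_max c) ->
  (forall c, vlab S (lab_before (even_row last)) c =
             vlab T (lab_before (even_row last)) c) ->
  S = graft S T.
Proof.
move=> he ho vb vm; rewrite [LHS]surjective_pairing.
congr pair; apply/ffunP => -[r c]; rewrite !ffunE /=; case: ltnP => // ler.
- have [r_odd|r_even] : r = odd_row last \/ r = even_row last.
    have ltr : (r < n.*2.+2)%N := ltn_ord r.
    have [e|e] : (r = n.*2 :> nat \/ r = n.*2.+1 :> nat) by lia.
      by left; apply: val_inj.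
    by right; apply: val_inj.
  by rewrite r_odd; apply: ho.
  by rewrite r_even; apply: he.
- have [r_mid|r_bot] : r = lab_before (even_row last) \/ r = ord_max.
    have ltr : (r < n.*2.+3)%N := ltn_ord r.
    have [e|e] : (r = n.*2.+1 :> nat \/ r = n.*2.+2 :> nat) by lia.
      by left; apply: val_inj.
    by right; apply: val_inj.
  by rewrite r_mid; apply: vm.
  by rewrite r_bot; apply: vb.
Qed.

Definition graft_set sigma (mu : 'I_n.+1 -> int) T : set (state n.+1 L) :=
  [set S | [/\ boundary sigma mu S, S = graft S T &
     forall c, vlab S (lab_before (odd_row last)) c =
               vlab T (lab_before (odd_row last)) c]]%classic.

Definition bottom_boundary (k : scolor n.+1) T : Prop :=
  [/\ hlab T (odd_row last) ord_max = None,
      hlab T (even_row last) ord_max = Some k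
    & forall c : 'I_L, vlab T ord_max c = evec None].

Lemma graft_boundary sigma sigma' mu S T :
  (forall i : 'I_n.+1, i != last -> sigma (inl i) = sigma' (inl i)) ->
  bottom_boundary (sigma' (inl last)) T ->
  boundary sigma mu S -> boundary sigma' mu (graft S T).
Proof.
move=> eqs [To Te Tb] [So Se Sb St].
have lti (i : 'I_n.+1) : i != last -> (i < n)%N.
  by move=> ni; rewrite ltn_neqAle -ltnS ltn_ord andbT.
split=> [i|i|c|c].
- rewrite hlab_graft /= ltn_double; have [->|/lti ->] := eqVneq i last.
    by rewrite ltnn.
  exact: So.
- rewrite hlab_graft /= ltn_Sdouble; have [->|ni] := eqVneq i last.
    by rewrite ltnn.
  by rewrite lti // Se eqs.
- by rewrite vlab_graft /= ifF ?Tb //; lia.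
- by rewrite vlab_graft /= St.
Qed.

(** Replacing the last two rows changes nothing above them, and grafting [T] back inverts the
    operation. *)
Lemma graft_set_bij sigma sigma' mu T T' :
  (forall i : 'I_n.+1, i != last -> sigma (inl i) = sigma' (inl i)) ->
  bottom_boundary (sigma (inl last)) T ->
  bottom_boundary (sigma' (inl last)) T' ->
  (forall c, vlab T (lab_before (odd_row last)) c =
             vlab T' (lab_before (odd_row last)) c) ->
  set_bij (graft_set sigma mu T) (graft_set sigma' mu T') (graft ^~ T').
Proof.
move=> eqs bT bT' eqT; split.
- move=> S [bS _ vS]; split; first exact: graft_boundary bS.
    by rewrite graft_graft.
  by move=> c; rewrite vlab_graft leqnn vS eqT.
- move=> S1 S2 /set_mem[_ -> _] /set_mem[_ -> _] /(congr1 (graft ^~ T)).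
  by rewrite !graft_graft.
- move=> S [bS eS vS]; exists (graft S T); last by rewrite graft_graft.
  split; last 2 first.
  + by rewrite graft_graft.
  + by move=> c; rewrite vlab_graft leqnn vS eqT.
  by apply: graft_boundary bS => // i /eqs.
Qed.

End Grafting.

Section PairWeights.
Variables (F : fieldType) (L : nat) (q sqrtq nu t s : F).

Definition pair_weight N (x : F) (i : 'I_N) (S : state N L) : F :=
  cap_weight sqrtq nu t x (hlab S (even_row i) ord0) (hlab S (odd_row i) ord0) *
  \prod_(c < L)
    (gamma_weight q s x
       (vlab S (lab_at (even_row i)) c) (hlab S (even_row i) (lab_at c))
       (vlab S (lab_before (even_row i)) c) (hlab S (even_row i) (lab_before c)) *
     delta_weight q s x
       (vlab S (lab_at (odd_row i)) c) (hlab S (odd_row i) (lab_before c))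
       (vlab S (lab_before (odd_row i)) c) (hlab S (odd_row i) (lab_at c))).

Variable n : nat.
Implicit Types (S T : state n.+1 L) (x : 'I_n.+1 -> F).
Let last : 'I_n.+1 := ord_max.

Definition upper_weight x S : F :=
  \prod_(i < n) pair_weight (x (widen_ord (leqnSn n) i)) (widen_ord (leqnSn n) i) S.

Lemma state_weight_split x S :
  state_weight q sqrtq nu t s x S = upper_weight x S * pair_weight (x last) last S.
Proof. by rewrite /state_weight big_ord_recr. Qed.

Lemma upper_weight_graft x S T : upper_weight x (graft S T) = upper_weight x S.
Proof.
apply: eq_bigr => i _; rewrite /pair_weight.
have lti := ltn_ord i.
have he j : hlab (graft S T) (even_row (widen_ord (leqnSn n) i)) j =
            hlab S (even_row (widen_ord (leqnSn n) i)) j.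
  by rewrite hlab_graft /= ltn_Sdouble lti.
have ho j : hlab (graft S T) (odd_row (widen_ord (leqnSn n) i)) j =
            hlab S (odd_row (widen_ord (leqnSn n) i)) j.
  by rewrite hlab_graft /= ltn_double lti.
rewrite he ho; congr (_ * _); apply: eq_bigr => c _.
rewrite !he !ho !vlab_graft /= /bump /=.
by rewrite !ifT //; lia.
Qed.

Lemma eq_upper_weight x x' :
  (forall i, i != last -> x i = x' i) -> upper_weight x =1 upper_weight x'.
Proof.
move=> eqx S; apply: eq_bigr => i _; rewrite eqx //.
by rewrite -val_eqE /= ltn_eqF.
Qed.

Lemma pair_weight_graft (y : F) S T :
  (forall c, vlab S (lab_before (odd_row last)) c =
             vlab T (lab_before (odd_row last)) c) ->
  pair_weight y last (graft S T) = pair_weight y last T.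
Proof.
move=> eqv; rewrite /pair_weight.
have he j : hlab (graft S T) (even_row last) j = hlab T (even_row last) j.
  by rewrite hlab_graft /= ltnNge leqnSn.
have ho j : hlab (graft S T) (odd_row last) j = hlab T (odd_row last) j.
  by rewrite hlab_graft /= ltnn.
rewrite he ho; congr (_ * _); apply: eq_bigr => c _.
rewrite !he !ho !vlab_graft /= -eqv /bump /=.
rewrite !add1n leqnn ltnn.
by rewrite ltnNge leqnSn.
Qed.

(** The factor U of the overview, for the last two rows [T]. *)
Definition graft_sum (sigma : {perm scolor n.+1}) mu x T : F :=
  \sum_(S \in graft_set sigma mu T) upper_weight x S.

Lemma graft_set_sum sigma mu x T :
  \sum_(S \in graft_set sigma mu T) state_weight q sqrtq nu t s x S =
  pair_weight (x last) last T * graft_sum sigma mu x T.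
Proof.
rewrite /graft_sum mulr_fsumr; apply: eq_fsbigr => S /set_mem[_ eS vS].
by rewrite state_weight_split mulrC eS pair_weight_graft // -eS.
Qed.

(** This is the independence of U from x_n and sigma(n): the bijection [graft_set_bij] preserves the
    upper rows, so only the interface labels of [T] matter. *)
Lemma eq_graft_sum (sigma sigma' : {perm scolor n.+1}) mu x x' T T' :
  (forall i : 'I_n.+1, i != last -> sigma (inl i) = sigma' (inl i)) ->
  (forall i : 'I_n.+1, i != last -> x i = x' i) ->
  bottom_boundary (sigma (inl last)) T ->
  bottom_boundary (sigma' (inl last)) T' ->
  (forall c, vlab T (lab_before (odd_row last)) c =
             vlab T' (lab_before (odd_row last)) c) ->
  graft_sum sigma mu x T = graft_sum sigma' mu x' T'.
Proof.
move=> eqs eqx bT bT' eqT; rewrite /graft_sum.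
rewrite [RHS](reindex_fsbig _ _ _ _ (graft_set_bij mu eqs bT bT' eqT)).
by apply: eq_fsbigr => S _; rewrite upper_weight_graft (eq_upper_weight eqx).
Qed.

End PairWeights.

(** * The weight of the last two rows *)

Section VertexWeights.
Variables (F : fieldType) (n : nat) (q s x : F).
Hypotheses (q0 : q != 0) (s0 : s != 0) (sx1 : 1 - s * x != 0).
Implicit Types (b : bool) (k : scolor n).

(* Weights of the vertices met by a single path of a color of sign b: g for
   Gamma, d for Delta; [dturn] and [dpass] are for a path entering from below,
   the others for a horizontal one. *)
Definition gthru b := (if b then s^-1 else s) * ((s - x) / (1 - s * x)).
Definition dthru b := (if b then s else s^-1) * ((s - x) / (1 - s * x)).
Definition gup b := (if b then x / s else 1) * ((1 - s ^+ 2) / (1 - s * x)).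
Definition dup b := (if b then 1 else x / s) * ((1 - s ^+ 2) / (1 - s * x)).
Definition dturn b := (if b then s * x else q^-1) * ((q - 1) / (1 - s * x)).
Definition dpass b := ((if b then 1 else q^-1) - s * x * (if b then q else 1)) / (1 - s * x).

Lemma clt_None k : clt None (Some k) = ~~ is_pos k.
Proof. by case: k => i; rewrite /clt /=; have := ltn_ord i; lia. Qed.

Lemma clt_Some_None k : clt (Some k) None = is_pos k.
Proof. by case: k => i; rewrite /clt /=; have := ltn_ord i; lia. Qed.

Let sums := (sum_on0, sum_on_evec).

Lemma gamma_weight_none : gamma_weight q s x (0 : cvec n) None 0 None = 1.
Proof.
rewrite /gamma_weight eqxx /= /sum_pos /sum_neg !sums.
by rewrite expr0 invr1 mulr1 divff.
Qed.

Lemma gamma_weight_thru k :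
  gamma_weight q s x 0 (Some k) 0 (Some k) = gthru (is_pos k).
Proof.
rewrite /gamma_weight /gthru !eqxx /= /sum_le /sum_gt !sums cvec0E.
by case: k => i /=; field; rewrite ?q0 ?s0 ?sx1 ?oner_eq0.
Qed.

Lemma gamma_weight_up k :
  gamma_weight q s x 0 (Some k) (evec (Some k)) None = gup (is_pos k).
Proof.
rewrite /gamma_weight /gup evec_None addr0 add0r eqxx clt_Some_None.
rewrite /sum_pos /sum_neg !sums.
by case: k => i /=; field; rewrite ?q0 ?s0 ?sx1 ?oner_eq0.
Qed.

Lemma delta_weight_none : delta_weight q s x (0 : cvec n) None 0 None = 1.
Proof.
rewrite /delta_weight eqxx /= /sum_pos /sum_neg !sums.
by rewrite expr0 invr1 mulr1 divff.
Qed.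

Lemma delta_weight_thru k :
  delta_weight q s x 0 (Some k) 0 (Some k) = dthru (is_pos k).
Proof.
rewrite /delta_weight /dthru !eqxx /= /sum_lt /sum_gt !sums cvec0E.
by case: k => i /=; field; rewrite ?q0 ?s0 ?sx1 ?oner_eq0.
Qed.

Lemma delta_weight_up k :
  delta_weight q s x 0 (Some k) (evec (Some k)) None = dup (is_pos k).
Proof.
rewrite /delta_weight /dup evec_None addr0 add0r eqxx clt_Some_None.
rewrite /sum_pos /sum_neg !sums.
by case: k => i /=; field; rewrite ?q0 ?s0 ?sx1 ?oner_eq0.
Qed.

Lemma delta_weight_turn k :
  delta_weight q s x (evec (Some k)) None 0 (Some k) = dturn (is_pos k).
Proof.
rewrite /delta_weight /dturn evec_None addr0 add0r eqxx clt_None.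
rewrite /sum_lt /sum_ge !sums evecE eqxx /clt /cle ltnn leqnn.
by case: k => i /=; field; rewrite ?q0 ?s0 ?sx1 ?oner_eq0.
Qed.

Lemma delta_weight_pass k :
  delta_weight q s x (evec (Some k)) None (evec (Some k)) None = dpass (is_pos k).
Proof.
rewrite /delta_weight /dpass eqxx /= /sum_pos /sum_neg !sums /is_neg.
by case: k => i /=; field; rewrite ?q0 ?s0 ?sx1 ?oner_eq0.
Qed.

End VertexWeights.

Section Products.
Variable (R : comPzRingType).

(** The path crosses the [L - a] columns to the left of column [a], turns up there with weight [u],
    and leaves the columns to the right empty. *)
Lemma prod_gamma_row (L a : nat) (u g : R) : (a <= L)%N ->
  \prod_(c < L) (if (a <= c)%N then g else if c.+1 == a then u else 1) =
  (if a == 0%N then 1 else u) * g ^+ (L - a).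
Proof.
elim: L => [|L IH] leaL; first by move: leaL; rewrite leqn0 big_ord0 => ->; rewrite mul1r.
rewrite big_ord_recr /=; case: (ltngtP a L.+1) leaL => // [ltaL|->] _.
  have leaL : (a <= L)%N by [].
  by rewrite leaL IH // subSn // exprSr mulrA.
rewrite ltnn subnn mulr1 big1 ?mul1r // => c _.
by rewrite leqNgt ltnS ltnW // eqSS ltn_eqF.
Qed.

(** Entering from below costs [r], each crossing [g] and leaving [w]; if entry and exit share a
    column, the single vertex of weight [p] replaces all of these. *)
Lemma prod_delta_row (L a d : nat) (r p w g : R) : (d < L)%N -> (a <= d.+1)%N ->
  \prod_(c < L) (if (c < d)%N then if (a <= c)%N then g else if c.+1 == a then r else 1
                 else if c == d :> nat then if c.+1 == a then p else w else 1) =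
  if a == d.+1 then p else (if a == 0%N then 1 else r) * g ^+ (d - a) * w.
Proof.
elim: L => // L IH; rewrite ltnS leq_eqVlt big_ord_recr /= => /predU1P[->|ltd] lead.
  rewrite ltnn eqxx eq_sym.
  under eq_bigr => c _ do rewrite ltn_ord.
  case: (ltngtP a L.+1) lead => // [lta|->] _.
    by rewrite prod_gamma_row.
  rewrite big1 ?mul1r // => c _.
  by rewrite leqNgt ltnS ltnW // eqSS ltn_eqF.
by rewrite IH // ltnNge (ltnW ltd) /= (gtn_eqF ltd) mulr1.
Qed.

End Products.

Section BottomRows.
Variables (n L : nat).
Let last : 'I_n.+1 := ord_max.
Implicit Types (c k : scolor n.+1).

(* The last two rows of the states in which the path of color c leaves the lower
   one upwards in column a (or through the cap if a = 0, becoming k) and the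
   upper one in column d+1. The labels of the other rows are irrelevant. *)
Definition bottom_state c (a : nat) k (d : nat) : state n.+1 L :=
  ([ffun rj : 'I_(n.+1.*2) * 'I_L.+1 =>
      if rj.1 == even_row last then if (a <= rj.2)%N then Some c else None
      else if (a <= rj.2 <= d)%N then Some k else None],
   [ffun rc : 'I_(n.+1.*2).+1 * 'I_L =>
      if rc.1 == ord_max then 0
      else if rc.1 == lab_before (even_row last) then
        if rc.2.+1 == a then evec (Some k) else 0
      else if rc.2 == d :> nat then evec (Some k) else 0]).

(** The admissible data: the path moves to the left in the upper of the two rows, and its color can
    change only at the cap, hence only if [a = 0]. *)
Definition profile c k (a d : nat) : bool :=
  (a <= d.+1)%N && ((k == c) || (a == 0%N) && (k == bar c)).

Lemma profile_neq0 c k a d : profile c k a d -> a != 0%N -> k = c.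
Proof. by case/andP=> _ /orP[/eqP->|/andP[/eqP->]]. Qed.

Lemma hlab_bottom_even c a k d j :
  hlab (bottom_state c a k d) (even_row last) j =
  if (a <= j)%N then Some c else None.
Proof. by rewrite /hlab ffunE eqxx. Qed.

Lemma hlab_bottom_odd c a k d j :
  hlab (bottom_state c a k d) (odd_row last) j =
  if (a <= j <= d)%N then Some k else None.
Proof. by rewrite /hlab ffunE -val_eqE /= ltn_eqF. Qed.

Lemma vlab_bottom_max c a k d j : vlab (bottom_state c a k d) ord_max j = 0.
Proof. by rewrite /vlab ffunE eqxx. Qed.

Lemma vlab_bottom_mid c a k d j :
  vlab (bottom_state c a k d) (lab_before (even_row last)) j =
  if j.+1 == a then evec (Some k) else 0.
Proof. by rewrite /vlab ffunE eqxx -val_eqE /= ltn_eqF. Qed.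

Lemma vlab_bottom_top c a k d j :
  vlab (bottom_state c a k d) (lab_before (odd_row last)) j =
  if j == d :> nat then evec (Some k) else 0.
Proof.
rewrite /vlab ffunE -!val_eqE /=; have -> : (n.*2 == n.+1.*2) = false by lia.
by rewrite (ltn_eqF (ltnSn _)).
Qed.

Lemma bottom_state_boundary c a k (d : 'I_L) :
  (a <= L)%N -> bottom_boundary c (bottom_state c a k d).
Proof.
move=> leaL; split=> [||j].
- by rewrite hlab_bottom_odd /= [(L <= d)%N]leqNgt ltn_ord andbF.
- by rewrite hlab_bottom_even /= leaL.
- by rewrite vlab_bottom_max evec_None.
Qed.

(** The single occupied edge on top gives [d] and [k], and the extent of the path in the even row
    gives [a]. *)
Lemma bottom_state_inj c k k' a a' (d d' : 'I_L) (S : state n.+1 L) :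
  (a <= L)%N -> (a' <= L)%N ->
  (forall j, hlab S (even_row last) j = hlab (bottom_state c a k d) (even_row last) j) ->
  (forall j, hlab S (even_row last) j = hlab (bottom_state c a' k' d') (even_row last) j) ->
  (forall j, vlab S (lab_before (odd_row last)) j =
             vlab (bottom_state c a k d) (lab_before (odd_row last)) j) ->
  (forall j, vlab S (lab_before (odd_row last)) j =
             vlab (bottom_state c a' k' d') (lab_before (odd_row last)) j) ->
  [/\ a = a', k = k' & d = d'].
Proof.
move=> leaL lea'L h h' v v'.
have : evec (Some k) = if d == d' then evec (Some k') else 0.
  have := v' d; rewrite v !vlab_bottom_top eqxx => ->.
  by rewrite -val_eqE.
have [<-|_] := eqVneq d d'; last by rewrite -evec_None => /evec_inj.
move=> /evec_inj[<-]; split=> //.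
have leq i : (i <= L)%N -> (a <= i)%N = (a' <= i)%N.
  move=> lei; have lti : (i < L.+1)%N by [].
  have := h' (Ordinal lti); rewrite h !hlab_bottom_even /=.
  by case: (a <= i)%N; case: (a' <= i)%N.
by apply/eqP; rewrite eqn_leq leq // leqnn -leq // leqnn.
Qed.

Section Weights.
Variables (F : fieldType) (q sqrtq nu t s : F).

(** A nonzero weight forces conservation at every vertex and an allowed pair of labels at the cap,
    so [gamma_path] and then [delta_path] determine both rows. *)
Lemma neq0_bottom_state c (y : F) (S : state n.+1 L) :
  pair_weight q sqrtq nu t s y last S != 0 ->
  bottom_boundary c S ->
  exists a k (d : 'I_L), [/\ (a <= L)%N, profile c k a d,
    S = graft S (bottom_state c a k d) &
    forall j, vlab S (lab_before (odd_row last)) j =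
              vlab (bottom_state c a k d) (lab_before (odd_row last)) j].
Proof.
rewrite /pair_weight mulf_eq0 negb_or => /andP[cap0 /prodf_neq0 W] [ho he vb].
pose h j := hlab S (even_row last) (inord j).
pose h' j := hlab S (odd_row last) (inord j).
have at_inord (j : 'I_L) : lab_at j = inord j.+1.
  by apply: val_inj; rewrite /= inordK // ltnS.
have before_inord (j : 'I_L) : lab_before j = inord j.
  by apply: val_inj; rewrite /= inordK // ltnS ltnW.
have max_inord : ord_max = inord L :> 'I_L.+1.
  by apply: val_inj; rewrite /= inordK.
have zero_inord : ord0 = inord 0 :> 'I_L.+1.
  by apply: val_inj; rewrite /= inordK.
pose V j := if insub j is Some c' then vlab S (lab_before (even_row last)) c' else 0.
pose K j := if insub j is Some c' then vlab S (lab_before (odd_row last)) c' else 0.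
have VE (j : 'I_L) : V j = vlab S (lab_before (even_row last)) j by rewrite /V valK.
have KE (j : 'I_L) : K j = vlab S (lab_before (odd_row last)) j by rewrite /K valK.
have consG j : (j < L)%N -> evec (h j.+1) = V j + evec (h j).
  move=> ltj; have := W (Ordinal ltj) isT.
  rewrite mulf_eq0 negb_or => /andP[/gamma_weight_neq0 + _].
  rewrite lab_at_even_row_max vb evec_None add0r at_inord before_inord => ->.
  by rewrite -VE.
have hL : h L = Some c by rewrite /h -max_inord.
have [a leaL [ha Va]] := gamma_path hL consG.
have [k pk h'0] : exists2 k, (k == c) || (a == 0%N) && (k == bar c) &
    h' 0%N = if a == 0%N then Some k else None.
  move: cap0; rewrite zero_inord -/(h 0%N) -/(h' 0%N) ha // leqn0 /cap_weight.
  case: (a =P 0%N) => /= _; last first.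
    by case: (h' 0%N =P None) => [-> _|]; [exists c; rewrite ?eqxx|rewrite eqxx].
  case: (h' 0%N =P Some (bar c)) => [-> _|_]; first by exists (bar c); rewrite ?eqxx ?orbT.
  by case: (h' 0%N =P Some c) => [-> _|]; [exists c; rewrite ?eqxx|rewrite eqxx].
have kc : a != 0%N -> k = c by case/orP: pk => [/eqP->|/andP[/eqP->]].
(* The color [c] may be replaced by [k]: they can differ only if [a = 0], when the first branch
   never occurs. *)
have Vk j : (j < L)%N -> V j = if j.+1 == a then evec (Some k) else 0.
  by move=> ltj; rewrite Va //; case: eqP => // eqa; rewrite kc // -eqa.
have consD j : (j < L)%N ->
    (if j.+1 == a then evec (Some k) else 0) + evec (h' j) = K j + evec (h' j.+1).
  move=> ltj; have := W (Ordinal ltj) isT.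
  rewrite mulf_eq0 negb_or => /andP[_ /delta_weight_neq0].
  by rewrite lab_at_odd_row at_inord before_inord -VE -KE Vk.
have h'L : h' L = None by rewrite /h' -max_inord.
have [d /andP[ltd lead] [h'd Kd]] := delta_path leaL h'0 h'L consD.
exists a, k, (Ordinal ltd); split=> //.
- by rewrite /profile lead pk.
- apply: graft_eq => j.
  + by rewrite hlab_bottom_even -(ha j (ltn_ord j)) /h inord_val.
  + by rewrite hlab_bottom_odd -(h'd j (ltn_ord j)) /h' inord_val.
  + by rewrite vb vlab_bottom_max evec_None.
  + by rewrite vlab_bottom_mid -Vk // VE.
- by move=> j; rewrite vlab_bottom_top -Kd // KE.
Qed.

(** The weight Z_c of the overview, with exit in the column labelled [d.+1]. *)
Definition path_weight c (y : F) k (d : nat) : F :=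
  \sum_(a < L.+1 | profile c k a d)
     pair_weight q sqrtq nu t s y last (bottom_state c a k d).

Lemma partition_function_path_weight (sigma : {perm scolor n.+1}) mu (x : 'I_n.+1 -> F) :
  partition_function L q sqrtq nu t s sigma mu x =
  \sum_(d < L) \sum_k path_weight (sigma (inl last)) (x last) k d *
     graft_sum q sqrtq nu t s sigma mu x (bottom_state (sigma (inl last)) 0 k d).
Proof.
set c := sigma (inl last).
(* The contributing states are sorted by [p], the triple of [d], [k] and [a]. *)
pose B (p : 'I_L * scolor n.+1 * 'I_L.+1) : set (state n.+1 L) :=
  if profile c p.1.2 p.2 p.1.1
  then graft_set sigma mu (bottom_state c p.2 p.1.2 p.1.1) else set0.
have in_B S p : B p S -> [/\ boundary sigma mu S,
    forall j, hlab S (even_row last) j =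
      hlab (bottom_state c p.2 p.1.2 p.1.1) (even_row last) j &
    forall j, vlab S (lab_before (odd_row last)) j =
      vlab (bottom_state c p.2 p.1.2 p.1.1) (lab_before (odd_row last)) j].
  rewrite /B; case: ifP => // _ [bS eS vS]; split=> // j.
  by rewrite eS hlab_graft /= ltnNge leqnSn.
have bot (S : state n.+1 L) : boundary sigma mu S -> bottom_boundary c S by case=> So Se Sb _; split.
rewrite /partition_function (@fsbig_partition _ _ _ _ B).
- under [RHS]eq_bigr => d _ do under eq_bigr => k _ do rewrite /path_weight big_distrl /=.
  rewrite pair_bigA /=; under [RHS]eq_bigr => p _ do rewrite big_mkcond.
  rewrite pair_bigA /=; apply: eq_bigr => -[[d k] a] _; rewrite /B /=.
  case: ifP => prof; last by rewrite fsbig_set0.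
  rewrite graft_set_sum; congr (_ * _).
  (* The interface labels depend only on [k] and [d], so [a] may be set to 0 in U, which then
     factors out of the sum over [a]. *)
  apply: eq_graft_sum => //.
  + by apply: bottom_state_boundary; rewrite -ltnS.
  + exact: bottom_state_boundary.
  + by move=> j; rewrite !vlab_bottom_top.
- exact: finite_contributing_states.
- by move=> p S /in_B[].
- move=> S /= bS; rewrite state_weight_split mulf_eq0 negb_or => /andP[_].
  move=> /neq0_bottom_state/(_ (bot S bS))[a [k [d [leaL prof eS vS]]]].
  have lta : (a < L.+1)%N by [].
  by exists (d, k, Ordinal lta); rewrite /B /= prof.
- move=> [[d k] a] [[d' k'] a'] S /in_B[_ h v] /in_B[_ h' v'].
  have [/= ea -> ->] := bottom_state_inj (ltn_ord a) (ltn_ord a') h h' v v'.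
  by congr (_, _, _); apply: val_inj.
Qed.

End Weights.
End BottomRows.

Section PathWeight.
Variables (F : fieldType) (n L : nat) (q sqrtq nu t s x : F).
Hypotheses (q0 : q != 0) (s0 : s != 0) (sx1 : 1 - s * x != 0).
Implicit Types (c k : scolor n.+1) (b : bool).

Definition cap_crossing b : F :=
  (if b then t else 1) * phi nu t (sqrtq^-1 * x^-1).

Lemma barK k : bar (bar k) = k.
Proof. by case: k. Qed.

Lemma bar_neq k : bar k != k.
Proof. by case: k. Qed.

Lemma is_pos_bar k : is_pos (bar k) = ~~ is_pos k.
Proof. by case: k. Qed.

Lemma cap_weight_bar c :
  cap_weight sqrtq nu t x (Some c) (Some (bar c)) = cap_crossing (is_pos c).
Proof. by rewrite /cap_weight eqxx /cap_crossing; case: ifP; rewrite ?mul1r. Qed.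

Lemma cap_weight_same c :
  cap_weight sqrtq nu t x (Some c) (Some c) = 1 - cap_crossing (is_pos c).
Proof.
rewrite /cap_weight (inj_eq Some_inj) eq_sym (negPf (bar_neq c)) eqxx.
by rewrite /cap_crossing; case: ifP; rewrite ?mul1r.
Qed.

Lemma pair_weight_bottom c k a (d : 'I_L) : (a <= L)%N -> profile c k a d ->
  pair_weight q sqrtq nu t s x ord_max (bottom_state L c a k d) =
  (if a == 0%N then cap_weight sqrtq nu t x (Some c) (Some k) else 1) *
  ((if a == 0%N then 1 else gup s x (is_pos c)) * gthru s x (is_pos c) ^+ (L - a)) *
  (if a == d.+1 then dpass q s x (is_pos k)
   else (if a == 0%N then 1 else dturn q s x (is_pos k)) *
        dthru s x (is_pos k) ^+ (d - a) * dup s x (is_pos k)).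
Proof.
move=> leaL prof; have lead : (a <= d.+1)%N by case/andP: prof.
rewrite /pair_weight big_split /= [LHS]mulrA -(prod_gamma_row (gup s x (is_pos c)) (gthru s x (is_pos c)) leaL).
rewrite -(prod_delta_row (dturn q s x (is_pos k)) (dpass q s x (is_pos k))
  (dup s x (is_pos k)) (dthru s x (is_pos k)) (ltn_ord d) lead).
congr (_ * _ * _).
- rewrite hlab_bottom_even hlab_bottom_odd /= leqn0 andbT.
  by case: eqP.
- apply: eq_bigr => j _.
  rewrite lab_at_even_row_max vlab_bottom_max !hlab_bottom_even vlab_bottom_mid /=.
  rewrite /bump /= add1n; case: (ltngtP j.+1 a) => [lta|lta|eqa].
  + by rewrite leqNgt (ltnW lta) gamma_weight_none.
  + by rewrite -ltnS lta gamma_weight_thru.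
  + have -> : k = c by apply: (profile_neq0 prof); rewrite -eqa.
    by rewrite -eqa ltnn gamma_weight_up.
- apply: eq_bigr => j _.
  rewrite lab_at_odd_row !hlab_bottom_odd vlab_bottom_mid vlab_bottom_top /=.
  rewrite /bump /= add1n; case: (ltngtP j.+1 a) => [lta|lta|eqa].
  + rewrite [(a <= j)%N]leqNgt (ltnW lta) /=.
    have -> : (j < d)%N by lia.
    by rewrite ltn_eqF ?delta_weight_none //; lia.
  + rewrite -ltnS lta /=; case: (ltngtP j d) => [ltd|gtd|_] /=.
    * by rewrite delta_weight_thru.
    * by rewrite delta_weight_none.
    * by rewrite delta_weight_up.
  + rewrite -eqa ltnn; case: (ltngtP j d) => [ltd|gtd|_] /=.
    * by rewrite delta_weight_turn.
    * by move: lead; rewrite -eqa ltnS leqNgt gtd.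
    * by rewrite delta_weight_pass.
Qed.

Lemma path_weight_eq0 c k d : k != c -> k != bar c ->
  path_weight L q sqrtq nu t s c x k d = 0.
Proof.
move=> nkc nkb; rewrite /path_weight big1 // => a.
by rewrite /profile (negPf nkc) (negPf nkb) !andbF.
Qed.

(** Crossing a column contributes [b_exp b * y] in a Gamma row and [y / b_exp b] in a Delta row. *)
Let b_exp b : F := if b then s^-1 else s.
Let y := (s - x) / (1 - s * x).

(** A change of color forces [a = 0]. The opposite sign in the upper row makes each of the [L + d]
    crossings weigh the same. *)
Lemma path_weight_bar c (d : 'I_L) :
  path_weight L q sqrtq nu t s c x (bar c) d =
  cap_crossing (is_pos c) * b_exp (is_pos c) ^+ (L + d) * y ^+ (L + d) *
    dup s x (~~ is_pos c).
Proof.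
rewrite /path_weight (bigD1 ord0) /=; last by rewrite /profile !eqxx orbT.
rewrite [X in _ + X]big1 ?addr0; last first.
  by move=> a /andP[/andP[_]]; rewrite -val_eqE (negPf (bar_neq c)) /= => /andP[->].
rewrite pair_weight_bottom //; last by rewrite /profile !eqxx orbT.
rewrite cap_weight_bar is_pos_bar /= !subn0 !mul1r.
have -> : dthru s x (~~ is_pos c) = gthru s x (is_pos c).
  by rewrite /dthru /gthru; case: (is_pos c).
by rewrite -[gthru _ _ _]/(b_exp (is_pos c) * y) !exprMn !exprD; ring.
Qed.

(** The quantity H of the overview, as a sum so that it makes sense also when z - 1/z vanishes. *)
Definition turn_sum (z : F) d := z * z ^- d * \sum_(i < d) (z ^+ 2) ^+ i.

(** The three terms come from [a = 0] (through the cap with unchanged color), [a = d.+1] (straight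
    up through one column) and the values of [a] in between. *)
Lemma path_weight_same c (d : 'I_L) : s - x != 0 ->
  path_weight L q sqrtq nu t s c x c d =
  b_exp (is_pos c) ^+ (L - d.+1) * y ^+ L *
  (b_exp (is_pos c) * y ^+ d * (1 - cap_crossing (is_pos c)) * dup s x (is_pos c)
   + gup s x (is_pos c) * dpass q s x (is_pos c) * y^-1 * y ^- d
   + gup s x (is_pos c) * dturn q s x (is_pos c) * dup s x (is_pos c)
     * b_exp (is_pos c) * y^-1 * turn_sum y d).
Proof.
move=> sx0; have y0 : y != 0 by rewrite mulf_neq0 ?invr_eq0.
set b := is_pos c; set e := b_exp b; set m := (L - d.+1)%N.
have e0 : e != 0 by rewrite /e /b_exp; case: ifP => _; rewrite ?invr_eq0.
have eL : L = (m + d.+1)%N by rewrite subnK.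
have gE : gthru s x b = e * y by [].
have dE : dthru s x b = e^-1 * y.
  by rewrite /dthru /e /b_exp; case: ifP => _; rewrite ?invrK.
move: (y) y0 gE dE => z z0 gE dE; clearbody e.
rewrite /path_weight.
have le2L : (d.+2 <= L.+1)%N by rewrite ltnS.
transitivity (\sum_(a < d.+2) pair_weight q sqrtq nu t s x ord_max (bottom_state L c a c d)).
  rewrite (big_ord_widen _ (fun a => pair_weight q sqrtq nu t s x ord_max
    (bottom_state L c a c d)) le2L).
  by apply: eq_bigl => a; rewrite /profile eqxx andbT.
rewrite big_ord_recl big_ord_recr /=.
have prof a : (a <= d.+1)%N -> profile c c a d by rewrite /profile eqxx andbT.
rewrite !pair_weight_bottom ?prof // cap_weight_same /bump !add1n //= eqxx.
rewrite !mul1r !subn0 -/b -/m gE dE [X in _ + (X + _)](_ : _ =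
  gup s x b * dturn q s x b * dup s x b * (e ^+ m * z ^+ L) *
    (e * z^-1 * turn_sum z d)); last first.
  rewrite /turn_sum !big_distrr /=.
  (* After reversal [i] is [d - a]: the path crosses [m + i.+1] columns in the even row and [i] in
     the odd one, whence the ratio [z ^+ 2]. *)
  rewrite (reindex_inj rev_ord_inj) /=; apply: eq_bigr => i _.
  have lti := ltn_ord i; have ltd := ltn_ord d.
  rewrite pair_weight_bottom ?prof; try lia.
  rewrite /bump /= !add1n ltn_eqF ?ltnS; last by lia.
  rewrite gE dE -/b.
  have -> : (d - (d - i.+1).+1 = i)%N by lia.
  have -> : (L - (d - i.+1).+1 = m + i.+1)%N by lia.
  rewrite [z ^+ L](_ : _ = z ^+ (m + i + (d - i.+1) + 2)); last by congr (_ ^+ _); lia.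
  rewrite [z ^+ d](_ : _ = z ^+ (i + (d - i.+1) + 1)); last by congr (_ ^+ _); lia.
  rewrite -exprM mul2n -addnn.
  move: (d - i.+1)%N => j; rewrite !exprMn !exprD exprVn !exprS expr0.
  have := expf_neq0 i e0; have := expf_neq0 i z0; have := expf_neq0 j z0.
  move: (e ^+ i) (z ^+ i) (z ^+ j) => ei zi zj zj0 zi0 ei0; field.
  by rewrite ei0 zi0 zj0 z0.
have expL (w : F) : w ^+ L = w ^+ m * (w * w ^+ d) by rewrite -exprS -exprD -eL.
rewrite !exprMn !expL exprVn.
have := expf_neq0 d e0; have := expf_neq0 d z0.
move: (e ^+ d) (z ^+ d) => ed zd zd0 ed0; field.
by rewrite ed0 zd0 z0.
Qed.

End PathWeight.

(** The exponents 1 - d + 2i, for i < d, are symmetric about 0. *)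
Lemma turn_sumV (F : fieldType) (y : F) d : y != 0 -> turn_sum y^-1 d = turn_sum y d.
Proof.
move=> y0; rewrite /turn_sum !big_distrr /= (reindex_inj rev_ord_inj) /=.
apply: eq_bigr => i _; rewrite -!exprM !mul2n -!addnn.
have yd : y ^+ d = y ^+ i * y ^+ (d - i.+1) * y.
  by rewrite -exprD -exprSr; congr (_ ^+ _); have := ltn_ord i; lia.
rewrite !exprVn !exprD yd.
have := expf_neq0 i y0; have := expf_neq0 (d - i.+1) y0.
move: (y ^+ i) (y ^+ (d - i.+1)) => yi yj yj0 yi0; field.
by rewrite y0 yi0 yj0 oner_eq0.
Qed.

Lemma turn_sumE (F : fieldType) (y : F) d : y != 0 ->
  y ^+ d = (y - y^-1) * turn_sum y d + y ^- d.
Proof.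
move=> y0; have yd0 : y ^+ d != 0 by rewrite expf_neq0.
have := subrX1 (y ^+ 2) d; rewrite -exprM mulnC exprM /turn_sum.
move: (\sum_(i < d) _) => G; move: (y ^+ d) yd0 => z z0 E.
have -> : (y - y^-1) * (y / z * G) = ((y ^+ 2 - 1) * G) / z.
  by field; rewrite y0 z0.
by rewrite -E; field.
Qed.

(** * The exchange relation *)

Section Identities.
Variables (F : fieldType) (q t s x P E H : F).
Hypotheses (q0 : q != 0) (t0 : t != 0) (s0 : s != 0) (x0 : x != 0).
Hypotheses (sx0 : s - x != 0) (sx1 : 1 - s * x != 0).
Hypotheses (x1 : 1 - x ^+ 2 != 0) (xq : x ^+ 2 - q != 0).
Hypotheses (P0 : P != 0) (Pqt : t * P - q - t != 0).

Let y := (s - x) / (1 - s * x).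
Let Y := (y - y^-1) * H + E.
(** [p] and [p'] are the values of [phi] in the caps at x and 1/x, written through [P] as in [phiE]
    and [phiVE]. *)
Let p := (q * x ^+ 2 - 1) / ((1 - x ^+ 2) * (t * P - q - t)).
Let p' := (q - x ^+ 2) / (t * (1 - x ^+ 2) * P).
Let Q := (1 - q * x ^+ 2) / (x ^+ 2 - q).

Let xs0 : x - s != 0.
Proof. by rewrite -opprB oppr_eq0. Qed.

(* D and D' are the normalized weights at x and 1/x; E stands for y^-d, H for
   [turn_sum y d] and hence Y for y^d. *)
Lemma same_color_identity :
  let D := s^-1 * Y * (1 - t * p) * dup s x true
    + gup s x true * dpass q s x true * y^-1 * E
    + gup s x true * dturn q s x true * dup s x true * s^-1 * y^-1 * H in
  let D' := s^-1 * E * (1 - t * p') * dup s x^-1 true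
    + gup s x^-1 true * dpass q s x^-1 true * y * Y
    + gup s x^-1 true * dturn q s x^-1 true * dup s x^-1 true * s^-1 * y * H in
  q * s^-1 * (p * dup s x true * Y) = P * (Q * D' - D) + D.
Proof.
rewrite /Y /Q /p /p' /y /gup /dup /dturn /dpass /=; field.
by rewrite sx1 sx0 s0 Pqt x1 x0 xs0 P0 t0 xq.
Qed.

(** The case of exit color [bar c]: the paths of color [c] change color at the cap, while the path
    of color [bar c] keeps its own. *)
Lemma opposite_color_identity :
  let D := t * p * dup s x false * Y in
  let D' := t * p' * dup s x^-1 false * E in
  q * s^-1 *
    (s * Y * (1 - p) * dup s x false
     + gup s x false * dpass q s x false * y^-1 * E
     + gup s x false * dturn q s x false * dup s x false * s * y^-1 * H)
  = P * (Q * D' - D) + D.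
Proof.
rewrite /Y /Q /p /p' /y /gup /dup /dturn /dpass /=; field.
by rewrite ?sx1 ?sx0 ?s0 ?Pqt ?x1 ?x0 ?xs0 ?P0 ?t0 ?xq ?q0.
Qed.

End Identities.

Section Exchange.
Variables (F : fieldType) (n L : nat) (q sqrtq nu t s x : F).
Hypotheses (sqrtqE : sqrtq ^+ 2 = q) (q0 : q != 0).
Hypotheses (nu0 : nu != 0) (t0 : t != 0) (s0 : s != 0) (x0 : x != 0).
Hypotheses (sx0 : s - x != 0) (sx1 : 1 - s * x != 0).
Hypotheses (x1 : 1 - x ^+ 2 != 0) (xq : x ^+ 2 - q != 0).
Hypotheses (den : phi_den nu t (sqrtq^-1 * x^-1) != 0).
Hypotheses (denV : phi_den nu t (sqrtq^-1 * x^-1^-1) != 0).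

Let P := (sqrtq - nu * t * x) * (sqrtq + nu^-1 * x) / (t * (1 - x ^+ 2)).
Let Q := (1 - q * x ^+ 2) / (x ^+ 2 - q).
Let y := (s - x) / (1 - s * x).

Let sqrtq0 : sqrtq != 0.
Proof. by move: q0; rewrite -sqrtqE expf_eq0. Qed.

(* sqrtq and nu enter the weights only through P, by which the cap weights at
   x and 1/x are expressed below. *)
Let PE : P = q * phi_den nu t (sqrtq^-1 * x^-1^-1) / (t * (1 - x ^+ 2)).
Proof.
by rewrite /P /phi_den -sqrtqE; field; rewrite sqrtq0 nu0 t0 x1 x0 oner_eq0.
Qed.

Let PqtE : t * P - q - t =
  q * x ^+ 2 * phi_den nu t (sqrtq^-1 * x^-1) / (1 - x ^+ 2).
Proof.
by rewrite /P /phi_den -sqrtqE; field; rewrite ?sqrtq0 ?nu0 ?t0 ?x1 ?x0 ?oner_eq0.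
Qed.

Let P0 : P != 0.
Proof. by rewrite PE (mulf_neq0 (mulf_neq0 q0 denV)) ?invr_eq0 ?(mulf_neq0 t0 x1). Qed.

Let Pqt0 : t * P - q - t != 0.
Proof.
by rewrite PqtE (mulf_neq0 (mulf_neq0 (mulf_neq0 q0 (expf_neq0 2 x0)) den)) ?invr_eq0.
Qed.

Let phiE : phi nu t (sqrtq^-1 * x^-1) =
  (q * x ^+ 2 - 1) / ((1 - x ^+ 2) * (t * P - q - t)).
Proof.
rewrite /phi PqtE exprMn !exprVn sqrtqE; move: (phi_den _ _ _) den => D D0.
by field; rewrite ?q0 ?x0 ?x1 ?D0 ?oner_eq0.
Qed.

Let phiVE : phi nu t (sqrtq^-1 * x^-1^-1) =
  (q - x ^+ 2) / (t * (1 - x ^+ 2) * P).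
Proof.
rewrite /phi PE exprMn !exprVn sqrtqE; move: (phi_den _ _ _) denV => D D0.
by field; rewrite ?q0 ?x0 ?x1 ?D0 ?t0 ?oner_eq0.
Qed.

Let xs0 : x - s != 0.
Proof. by rewrite -opprB oppr_eq0. Qed.

Let yVE : (s - x^-1) / (1 - s * x^-1) = y^-1.
Proof. by rewrite /y; field; rewrite ?sx0 ?sx1 ?x0 ?xs0. Qed.

Let y0 : y != 0.
Proof. by rewrite mulf_neq0 ?invr_eq0. Qed.

Lemma path_weight_exchange (c k : scolor n.+1) (d : 'I_L) : is_pos c ->
  q * s ^- (2 * L) * ((1 - s * x) / (s - x)) ^+ L *
    path_weight L q sqrtq nu t s (bar c) x k d =
  P * (Q * y ^+ L * path_weight L q sqrtq nu t s c x^-1 k d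
       - ((1 - s * x) / (s - x)) ^+ L * path_weight L q sqrtq nu t s c x k d)
  + ((1 - s * x) / (s - x)) ^+ L * path_weight L q sqrtq nu t s c x k d.
Proof.
move=> cpos.
have yV : (1 - s * x) / (s - x) = y^-1 by rewrite /y invf_div.
have expL (w : F) : w ^+ L = w ^+ (L - d.+1) * (w * w ^+ d).
  by rewrite -exprS -exprD subnK.
have sxV1 : 1 - s * x^-1 != 0.
  by rewrite -[1](divff x0) -mulrBl mulf_neq0 ?invr_eq0 ?xs0.
have sxV0 : s - x^-1 != 0.
  have -> : s - x^-1 = - ((1 - s * x) / x) by field.
  by rewrite oppr_eq0 mulf_neq0 ?invr_eq0.
have [[nkc nkb]|[->|->]] : k != c /\ k != bar c \/ k = c \/ k = bar c.
- have [->|nkc] := eqVneq k c; first by right; left.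
  by have [->|nkb] := eqVneq k (bar c); [right; right | left].
- by rewrite !path_weight_eq0 ?barK // !mulr0 subr0 mulr0 addr0.
- have Wbar := path_weight_bar sqrtq nu t q0 s0 sx1 (bar c) d.
  have W := path_weight_same sqrtq nu t q0 s0 sx1 c d sx0.
  have WV := path_weight_same sqrtq nu t q0 s0 sxV1 c d sxV0.
  have := same_color_identity (y ^- d) (turn_sum y d) t0 s0 x0 sx0 sx1 x1 xq P0 Pqt0.
  rewrite -/y -turn_sumE //= -phiE -phiVE -/Q.
  move: Wbar W WV; rewrite barK is_pos_bar cpos yVE turn_sumV // -/y /=.
  rewrite /cap_crossing mul1r !exprVn !invrK yV.
  set D := _ + _ * y^-1 * turn_sum y d; set D' := _ + _ * y * turn_sum y d.
  move=> -> -> -> I.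
  (* Once the powers [y ^+ L] cancel, this power of [s] is common to all terms, and [I] is what
     remains. *)
  transitivity (s ^- (L - d.+1) * (P * (Q * D' - D) + D)).
    rewrite -I mul2n -addnn exprVn !exprD !expL.
    have := expf_neq0 d y0; have := expf_neq0 d s0.
    have := expf_neq0 (L - d.+1) y0; have := expf_neq0 (L - d.+1) s0.
    move: (s ^+ _) (y ^+ (L - d.+1)) (s ^+ d) (y ^+ d) y0 => sm ym sd yd z0 sm0 ym0 sd0 yd0.
    by field; rewrite s0 z0 sm0 ym0 sd0 yd0.
  have yL0 := expf_neq0 L y0.
  by rewrite exprVn; field; rewrite yL0 expf_neq0.
- have W := path_weight_bar sqrtq nu t q0 s0 sx1 c d.
  have WV := path_weight_bar sqrtq nu t q0 s0 sxV1 c d.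
  have Wbar := path_weight_same sqrtq nu t q0 s0 sx1 (bar c) d sx0.
  have := opposite_color_identity (y ^- d) (turn_sum y d) q0 t0 s0 x0 sx0 sx1 x1 xq P0 Pqt0.
  rewrite -/y -turn_sumE //= -phiE -phiVE -/Q.
  move: Wbar W WV; rewrite is_pos_bar cpos yVE // -/y /=.
  rewrite /cap_crossing mul1r !exprVn !invrK yV.
  set D := _ + _ * y^-1 * turn_sum y d.
  move=> -> -> -> I.
  (* The common power is now the factor [b_exp] to the [L + d] of [path_weight_bar]. *)
  transitivity (s ^- (L + d) * (q * s^-1 * D)).
    rewrite mul2n -addnn exprVn !exprD !expL.
    have := expf_neq0 d y0; have := expf_neq0 d s0.
    have := expf_neq0 (L - d.+1) y0; have := expf_neq0 (L - d.+1) s0.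
    move: (s ^+ _) (y ^+ (L - d.+1)) (s ^+ d) (y ^+ d) y0 => sm ym sd yd z0 sm0 ym0 sd0 yd0.
    by field; rewrite s0 z0 sm0 ym0 sd0 yd0.
  rewrite I !exprD exprVn.
  have := expf_neq0 L y0; have := expf_neq0 L s0.
  have := expf_neq0 d y0; have := expf_neq0 d s0.
  move: (y ^+ L) (s ^+ L) (s ^+ d) (y ^+ d) => yL sL sd yd sd0 yd0 sL0 yL0.
  by field; rewrite sL0 yL0 sd0 yd0.
Qed.

End Exchange.

Theorem theorem3p3 (R : realType) (n L : nat) (q sqrtq nu t s : R[i])
    (x : 'I_n.+1 -> R[i]) (sigma sn : {perm scolor n.+1})
    (mu : 'I_n.+1 -> int) :
  (0 < L)%N ->
  sqrtq ^+ 2 = q -> q != 0 -> nu != 0 -> t != 0 -> s != 0 ->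
  regular_at sqrtq nu t s x ->
  regular_at sqrtq nu t s (invert_last x) ->
  s - x ord_max != 0 ->
  1 - x ord_max ^+ 2 != 0 ->
  x ord_max ^+ 2 - q != 0 ->
  sigma \in hyperoctahedral n.+1 ->
  (forall i, (1 <= `|mu i| <= L)%N) ->
  is_pos (sigma (inl ord_max)) ->
  sn \in hyperoctahedral n.+1 ->
  sn (inl ord_max) = inr ord_max ->
  (forall j : 'I_n.+1, (j < n)%N -> sn (inl j) = inl j) ->
  let f := @partition_function R[i] n.+1 L q sqrtq nu t s in
  let xn := x ord_max in
  q * s ^- (2 * L) * ((1 - s * xn) / (s - xn)) ^+ L
    * f (perm_comp sigma sn) mu x
  = (sqrtq - nu * t * xn) * (sqrtq + nu^-1 * xn) / (t * (1 - xn ^+ 2))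
      * ((1 - q * xn ^+ 2) / (xn ^+ 2 - q) * ((s - xn) / (1 - s * xn)) ^+ L
           * f sigma mu (invert_last x)
         - ((1 - s * xn) / (s - xn)) ^+ L * f sigma mu x)
    + ((1 - s * xn) / (s - xn)) ^+ L * f sigma mu x.
Proof.
move=> _ sqrtqE q0 nu0 t0 s0 /(_ ord_max)[x0 sx1 den] /(_ ord_max)[_ _ denV].
move=> sx0 x1 xq hyp _ cpos _ sn_last sn_lt f xn; rewrite {}/f.
have invE : invert_last x ord_max = xn^-1 by rewrite /invert_last eqxx.
rewrite invE in denV.
rewrite !partition_function_path_weight invE -/xn.
set c := sigma (inl ord_max) in cpos *.
have cbar : perm_comp sigma sn (inl ord_max) = bar c.
  rewrite permM sn_last; move: hyp; rewrite inE => /forallP/(_ (inl ord_max)).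
  by move/eqP.
have eqs i : i != ord_max -> perm_comp sigma sn (inl i) = sigma (inl i).
  by move=> ni; rewrite permM sn_lt // ltn_neqAle -ltnS ltn_ord andbT.
have eqU k (d : 'I_L) :
    graft_sum q sqrtq nu t s (perm_comp sigma sn) mu x (bottom_state L (bar c) 0 k d) =
    graft_sum q sqrtq nu t s sigma mu x (bottom_state L c 0 k d).
  apply: eq_graft_sum => //.
  - by rewrite cbar; apply: bottom_state_boundary.
  - exact: bottom_state_boundary.
have eqV k (d : 'I_L) :
    graft_sum q sqrtq nu t s sigma mu (invert_last x) (bottom_state L c 0 k d) =
    graft_sum q sqrtq nu t s sigma mu x (bottom_state L c 0 k d).
  apply: eq_graft_sum => //; try exact: bottom_state_boundary.
  by move=> i ni; rewrite /invert_last (negPf ni).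
(* All three partition functions now have the same factors U, so the relation is checked for each
   [d] and [k]. *)
rewrite cbar !pair_bigA !mulr_sumr -sumrB mulr_sumr -big_split /=.
apply: eq_bigr => -[d k] _ /=; rewrite eqU eqV [LHS]mulrA.
rewrite path_weight_exchange //; ring.
Qed.
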